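(* Let $G$ be a weighted directed graph that has a distinguished root vertex $r$ with $\deg^-(r)=0$ (no incoming edges), and every other vertex has $\deg^-=1$ (exactly one parent in $G$). If all vertices of $G$ are reachable from $r$, then the randomized zero forcing propagation process starting from $r$ is deterministic, and the expected propagation time $\operatorname{ept}_{\mathrm{rzf}}(G,r)$ equals the eccentricity of $r$ in $G$ (i.e., the distance from $r$ to the furthest vertex in the directed tree).
   Context: Randomized zero forcing (RZF): $G$ is a finite directed graph with nonnegative weights $w_{uv}$ on directed edges $(u,v)$, with $w_{uv}=0$ if there is no edge from $u$ to $v$. Start with blue set $B_0=S$. Given the blue set $B_t$, each white vertex $w\notin B_t$ independently becomes blue at round $t+1$ with probability $p_t(w)=\frac{\sum_{u\in B_t}w_{uw}}{\sum_{u\in V(G)}w_{uw}}$ if the denominator is positive, and $p_t(w)=0$ otherwise; blue vertices stay blue forever. Expected propagation time: if it is possible to color all of $G$ blue starting from $S$, then $\operatorname{ept}_{\mathrm{rzf}}(G,S)$ is the expected value of $\tau=\min\{t: B_t=V(G)\}$; otherwise it is $\infty$. $\operatorname{ept}_{\mathrm{rzf}}(G,v)$ means $\operatorname{ept}_{\mathrm{rzf}}(G,\{v\})$. $\deg^-(v)$ is the number of incoming edges of $v$. A vertex is reachable from $r$ if there is a directed path in $G$ from $r$ to it. ''Deterministic'' means that each blue set $B_t$ is almost surely equal to a fixed set. Distances are lengths (numbers of edges) of directed paths.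
   Formalization: Every directed edge is required to have positive weight (weight zero exactly when there is no edge); with a zero-weight edge, e.g. a single edge from r to v of weight 0, the vertex v is never coloured and the expected propagation time is infinite while the eccentricity is 1. *)

(* Defs.v *)
From HB Require Import structures.
From mathcomp Require Import all_boot all_order all_algebra.
From mathcomp Require Import all_classical all_reals all_analysis.

Set Implicit Arguments.
Unset Strict Implicit.
Unset Printing Implicit Defensive.

Import Order.TTheory GRing.Theory Num.Theory.
Local Open Scope classical_set_scope.
Local Open Scope ring_scope.

(* The edges are exactly the pairs of nonzero weight: an edge of weight zero
   would count for directed paths and in-degrees but could never transmit the
   colour blue. *)
Record wdigraph (R : realType) (V : finType) := WDigraph {
  edge : rel V;
  weight : V -> V -> R;
  weight_ge0 : forall u v, 0 <= weight u v;
  weight_eq0 : forall u v, (weight u v == 0) = ~~ edge u v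
}.

Definition indeg (R : realType) (V : finType) (G : wdigraph R V) (v : V) : nat :=
  #|[pred u | edge G u v]|.

(* The infimum over the directed walks from u to v of their number of edges;
   it is +oo when v is not reachable from u. *)
Definition dist (R : realType) (V : finType) (G : wdigraph R V) (u v : V) :
    \bar R :=
  ereal_inf [set (size p)%:R%:E | p in [set p | path (edge G) u p /\ last u p = v]].

Definition ecc (R : realType) (V : finType) (G : wdigraph R V) (u : V) : \bar R :=
  ereal_sup (range (dist G u)).

Definition blue_prob (R : realType) (V : finType) (G : wdigraph R V)
    (A : {set V}) (w : V) : R :=
  if 0 < \sum_u weight G u w
  then (\sum_(u in A) weight G u w) / (\sum_u weight G u w) else 0.

(* The probability that the blue set A is followed by A': the white vertices
   turn blue independently, and blue vertices stay blue. *)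
Definition rzf_step (R : realType) (V : finType) (G : wdigraph R V)
    (A A' : {set V}) : R :=
  if A \subset A'
  then \prod_(w | w \notin A)
         (if w \in A' then blue_prob G A w else 1 - blue_prob G A w)
  else 0.

(* A realization, on the probability space (T, P), of the process started from
   S. The last field says that, conditionally on the whole history
   B_0 = A_0, ..., B_t = A_t, the next blue set has law rzf_step G A_t. *)
Record rzf_process (R : realType) (d : measure_display) (T : measurableType d)
    (P : probability T R) (V : finType) (G : wdigraph R V) (S : {set V}) :=
  RZFProcess {
  blue : nat -> T -> {set V};
  blue_measurable : forall t A, measurable [set x | blue t x = A];
  blue_start : P [set x | blue 0 x = S] = 1%E;
  blue_step : forall (t : nat) (A : nat -> {set V}),
    P [set x | forall s, (s <= t.+1)%N -> blue s x = A s] =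
    (P [set x | forall s, (s <= t)%N -> blue s x = A s] *
     (rzf_step G (A t) (A t.+1))%:E)%E
}.

Section Propagation.
Context (R : realType) (d : measure_display) (T : measurableType d).
Context (P : probability T R) (V : finType) (G : wdigraph R V) (S : {set V}).
Variable X : rzf_process P G S.

Definition rzf_deterministic : Prop :=
  forall t, exists A : {set V}, {ae P, forall x, blue X t x = A}.

Definition prop_time (x : T) : \bar R :=
  match pselect (exists t, blue X t x == [set: V]%SET) with
  | left h => (ex_minn h)%:R%:E
  | right _ => +oo%E
  end.

Definition can_color_all : Prop :=
  exists t, (0 < P [set x | blue X t x = [set: V]%SET])%E.

Definition ept : \bar R :=
  if pselect can_color_all then (\int[P]_x prop_time x)%E else +oo%E.

End Propagation.

(* Main.v *)
Require Import Defs.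
From HB Require Import structures.
From mathcomp Require Import all_boot all_order all_algebra.
From mathcomp Require Import all_classical all_reals all_analysis.
From mathcomp Require Import measurable_realfun.

Import Order.TTheory GRing.Theory Num.Theory.
Local Open Scope classical_set_scope.
Local Open Scope ring_scope.

Set Implicit Arguments.
Unset Strict Implicit.

(** When every in-degree is at most 1, a white vertex turns blue with
    probability 1 or 0 according to whether its only parent is blue.  Hence
    [B_t] is almost surely the set of vertices at distance at most [t] from the
    start, and the propagation time is almost surely the first [t] for which
    this ball is the whole graph. *)

Section Balls.
Context (R : realType) (V : finType) (G : wdigraph R V).

Definition out_closure (A : {set V}) : {set V} :=
  [set w | (w \in A) || [exists u in A, edge G u w]]%SET.

Definition out_ball (S : {set V}) (t : nat) : {set V} := iter t out_closure S.

Lemma sub_out_closure (A : {set V}) : A \subset out_closure A.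
Proof. by apply/fintype.subsetP => w wA; rewrite inE wA. Qed.

(** Links the iterates to the walks over which [dist] takes its infimum. The length is bounded by
    [t] rather than equal to it because [out_closure] keeps the old vertices. *)
Lemma mem_out_ball (r v : V) (t : nat) :
  reflect (exists p, [/\ path (edge G) r p, last r p = v & (size p <= t)%N])
          (v \in out_ball [set r]%SET t).
Proof.
apply: (iffP idP).
  elim: t v => [|t IH] v /=; first by rewrite inE => /eqP ->; exists [::].
  rewrite inE => /orP[/IH[p [pp pv ps]]|/existsP[u /andP[/IH[p [pp pu ps]] uv]]].
    by exists p; split=> //; exact: leqW.
  exists (rcons p v); split.
  - by rewrite rcons_path pp pu.
  - by rewrite last_rcons.
  - by rewrite size_rcons.
elim: t v => [|t IH] v [p [pp pv ps]].
  by move: ps pv; rewrite leqn0 size_eq0 => /eqP -> /= <-; rewrite inE.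
(* A walk with at most [t] edges falls under the induction hypothesis; one with exactly [t.+1] edges
   does so once its last edge is removed. *)
rewrite inE; case: (leqP (size p) t) => [pt|tp].
  by rewrite IH //; exists p.
case/lastP: p => [|p u] // in pp pv ps tp *.
apply/orP; right; apply/existsP; exists (last r p).
move: pp pv ps; rewrite rcons_path last_rcons size_rcons => /andP[pp pu] <- ps.
by rewrite pu andbT; apply: IH; exists p.
Qed.

(** A walk shortened to distinct vertices has fewer than [#|V|] edges, so radius [#|V|] suffices. *)
Lemma out_ball_full (r : V) : (forall v, connect (edge G) r v) ->
  exists t, out_ball [set r]%SET t == [set: V]%SET.
Proof.
move=> rV; exists #|V|; rewrite -finset.subTset; apply/fintype.subsetP => v _.
apply/mem_out_ball; have /connectP[p pp pv] := rV v.
case: (shortenP pp) pv => q pq uq _ pv; exists q; split=> //.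
by have := uniq_leq_size uq (fun x _ => mem_enum V x); rewrite -cardE => /ltnW.
Qed.

(** The ball of radius [m] yields a walk of at most [m] edges to every vertex; by minimality the
    previous ball misses some vertex, which is then at distance at least [m]. *)
Lemma ecc_out_ball (r : V) (m : nat) :
  out_ball [set r]%SET m = [set: V]%SET ->
  (forall t, out_ball [set r]%SET t = [set: V]%SET -> (m <= t)%N) ->
  ecc G r = m%:R%:E.
Proof.
move=> ballm minm; apply/eqP; rewrite eq_le; apply/andP; split.
  apply: ge_ereal_sup => _ [v _ <-].
  have /mem_out_ball[p [pp pv ps]] : v \in out_ball [set r]%SET m.
    by rewrite ballm finset.in_setT.
  apply: (@le_trans _ _ (size p)%:R%:E); last by rewrite lee_fin ler_nat.
  by apply: ereal_inf_lbound; exists p.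
have [v far] : exists v, forall p, path (edge G) r p -> last r p = v ->
    (m <= size p)%N.
  (* For [m = 0] there is no previous ball, but the bound is trivial. *)
  case: m ballm minm => [|k] ballm minm; first by exists r.
  have /subsetPn[v _ vk] : ~~ ([set: V]%SET \subset out_ball [set r]%SET k).
    by rewrite finset.subTset; apply/negP => /eqP /minm; rewrite ltnn.
  exists v => p pp pv; rewrite ltnNge; apply: contra vk => pk.
  by apply/mem_out_ball; exists p.
apply: (@le_trans _ _ (dist G r v)).
  by apply: le_ereal_inf_tmp => _ [p [pp pv] <-]; rewrite lee_fin ler_nat far.
by apply: ereal_sup_ubound; exists v.
Qed.

(** Every factor of the product is 1: with at most one parent, each sum in [blue_prob] has at most
    one nonzero term, so the probability is 1 or 0 in agreement with membership in the closure. *)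
Lemma rzf_step_out_closure (A : {set V}) :
  (forall v, (indeg G v <= 1)%N) -> rzf_step G A (out_closure A) = 1.
Proof.
move=> indeg1; rewrite /rzf_step sub_out_closure; apply: big1 => w wA.
rewrite inE (negPf wA) /= /blue_prob.
have w0 u : ~~ edge G u w -> weight G u w = 0.
  by rewrite -weight_eq0 => /eqP.
case: (pickP [pred u | edge G u w]) => [u uw|noedge]; last first.
  (* Without a parent the denominator vanishes, [blue_prob] takes its default value 0, and [w] lies
     outside the closure. *)
  rewrite [\sum_u _]big1 => [|u _]; last by apply: w0; exact: negbT (noedge u).
  rewrite ltxx subr0; case: ifP => // /existsP[u /andP[_ uw]].
  by have := noedge u; rewrite /= uw.
have only v : v != u -> weight G v w = 0.
  move=> vu; apply: w0; apply/negP => vw; move: (indeg1 w).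
  by move/card_le1_eqP => /(_ v u vw uw) vuE; rewrite vuE eqxx in vu.
have uw_gt0 : 0 < weight G u w.
  by rewrite lt_neqAle weight_ge0 andbT eq_sym weight_eq0 negbK.
rewrite [\sum_v _](bigD1 u) //= big1 // addr0 uw_gt0.
(* The denominator is now [weight G u w]; the numerator is the same weight if [u] is in [A], and 0
   otherwise. *)
case: ifP => [/existsP[v /andP[vA vw]]|/negbT/existsPn uA].
  have vu : v = u.
    by apply/eqP; apply: contraT => /only/eqP; rewrite weight_eq0 vw.
  rewrite (bigD1 u) /= ?big1 -?vu //; last by move=> z /andP[_]; rewrite vu => /only.
  by rewrite addr0 divff // vu gt_eqF.
rewrite big1 ?mul0r ?subr0 // => v vA; apply: only; apply: contraTneq vA => ->.
by move: uw (uA u) => /= ->; rewrite andbT.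
Qed.

End Balls.

Section Process.
Context (R : realType) (d : measure_display) (T : measurableType d).
Context (P : probability T R) (V : finType) (G : wdigraph R V) (S : {set V}).
Variable X : rzf_process P G S.

Lemma measurable_history (t : nat) (A : nat -> {set V}) :
  measurable [set x | forall s, (s <= t)%N -> blue X s x = A s].
Proof.
rewrite [X in measurable X](_ : _ =
    \bigcap_(s in [set s | (s <= t)%N]) [set x | blue X s x = A s]) //.
by apply: bigcap_measurable => [|s _]; [exists 0%N|exact: blue_measurable].
Qed.

Lemma measurable_prop_time : measurable_fun [set: T] (prop_time X).
Proof.
pose hit t := [set x | blue X t x = [set: V]%SET].
have mhit t : measurable (hit t) by exact: blue_measurable.
pose first_hit t := hit t `&` \bigcap_(s in [set s | (s < t)%N]) ~` hit s.
have mfirst t : measurable (first_hit t).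
  apply: measurableI => //.
  by apply: bigcap_measurableType => s _; exact: measurableC.
move=> _ Y mY; rewrite setTI.
(* The preimage of [Y] splits by the first hitting time, a countable union, plus the event of never
   hitting; the constant preimage keeps the latter exactly when [+oo] is in [Y]. *)
rewrite [X in measurable X](_ : _ =
    (\bigcup_(t in [set t : nat | Y t%:R%:E]) first_hit t) `|`
    ((\bigcap_t ~` hit t) `&` (setT `&` cst +oo%E @^-1` Y))); last first.
  apply/seteqP; split=> x; rewrite /preimage /= /prop_time.
    case: pselect => [h|nh Yx].
      case: ex_minnP => t /eqP xt minx Yt; left; exists t => //; split=> // s st.
      by rewrite /hit /= => /eqP/minx; rewrite leqNgt st.
    by right; split=> // t _ xt; apply: nh; exists t; apply/eqP.
  case=> [[t Yt [xt xlt]]|[nx [_ Yx]]].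
    case: pselect => [h|[]]; last by exists t; apply/eqP.
    case: ex_minnP => s /eqP xs /(_ t); rewrite xt eqxx => /(_ isT) st.
    suff -> : s = t by [].
    apply/eqP; rewrite eqn_leq st leqNgt.
    by apply/negP => /xlt; exact.
  by case: pselect => // -[t xt]; case: (nx t I); apply/eqP.
apply: measurableU; first exact: bigcup_measurable.
apply: measurableI; last exact: measurable_cst.
by apply: bigcap_measurableType => t _; exact: measurableC.
Qed.

Hypothesis indeg1 : forall v, (indeg G v <= 1)%N.

Lemma blue_out_ball : {ae P, forall x, forall t, blue X t x = out_ball G S t}.
Proof.
(* Whole histories are followed because [blue_step] speaks only of them; each round contributes a
   factor 1. *)
have Phist t :
    P [set x | forall s, (s <= t)%N -> blue X s x = out_ball G S s] = 1%E.
  elim: t => [|t IH]; last by rewrite blue_step IH rzf_step_out_closure // mule1.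
  rewrite -(blue_start X); congr (P _); apply/seteqP; split=> x /=.
    by move=> /(_ 0%N); exact.
  by move=> x0 s; rewrite leqn0 => /eqP ->.
apply: ae_foralln => t.
exists (~` [set x | forall s, (s <= t)%N -> blue X s x = out_ball G S s]).
split=> [||x /= xt].
- exact/measurableC/measurable_history.
- apply: etrans (probability_setC P (measurable_history _ _)) _.
  by rewrite Phist subee.
- by apply: contra_not xt; exact.
Qed.

(** The propagation time is almost surely the constant [m], so its integral over a probability space
    is [m]. *)
Lemma ept_out_ball (m : nat) :
  out_ball G S m = [set: V]%SET ->
  (forall t, out_ball G S t = [set: V]%SET -> (m <= t)%N) ->
  ept X = m%:R%:E.
Proof.
move=> ballm minm.
have timem : {ae P, forall x, prop_time X x = m%:R%:E}.
  apply: filterS blue_out_ball => x xE; rewrite /prop_time.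
  case: pselect => [h|[]]; last by exists m; rewrite xE ballm.
  case: ex_minnP => n; rewrite xE => /eqP balln /(_ m).
  rewrite xE ballm eqxx => /(_ isT) nm.
  by congr (_%:R%:E); apply/eqP; rewrite eqn_leq nm minm.
rewrite /ept; case: pselect => [can|[]] /=.
  rewrite (ae_eq_integral (cst m%:R%:E)) //; first last.
  - by apply: filterS timem => x xm _.
  - exact: measurable_prop_time.
  rewrite integral_cst // -[RHS]mule1; congr (_ * _)%E; exact: probability_setT.
(* It remains to exclude the default value [+oo] of [ept]: the graph is entirely blue at time [m]
   with probability 1. *)
have mblue : measurable [set x | blue X m x = [set: V]%SET].
  exact: blue_measurable.
exists m; rewrite -[X in P X]setCK probability_setC; last exact: measurableC.
rewrite (measure_negligible (measurableC mblue)) ?sube0 ?lte01 //.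
by apply: filterS blue_out_ball => x xE /=; rewrite xE ballm.
Qed.

End Process.

Theorem theorem3p1 (R : realType) (V : finType) (G : wdigraph R V) (r : V)
    (root_indeg : indeg G r = 0%N)
    (nonroot_indeg : forall v : V, v != r -> indeg G v = 1%N)
    (all_reachable : forall v : V, connect (edge G) r v)
    (d : measure_display) (T : measurableType d) (P : probability T R)
    (X : rzf_process P G [set r]%SET) :
  rzf_deterministic X /\ ept X = ecc G r.
Proof.
have indeg1 v : (indeg G v <= 1)%N.
  by have [->|/nonroot_indeg ->] := eqVneq v r; rewrite ?root_indeg.
split=> [t|].
  exists (out_ball G [set r]%SET t).
  by apply: filterS (blue_out_ball X indeg1) => x; exact.
(* The least radius [m] of a full ball is the common value of both sides. *)
case: (ex_minnP (out_ball_full all_reachable)) => m /eqP ballm minm.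
have {}minm t : out_ball G [set r]%SET t = [set: V]%SET -> (m <= t)%N.
  by move=> /eqP; exact: minm.
by rewrite (ept_out_ball X indeg1 ballm) // (ecc_out_ball ballm).
Qed.
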